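(* Let $n\ge 3$ and let $k$ be an integer with $0\le k\le n-3$ or $k=n-1$. Let $\Gamma$ be a connected simple graph of order $n$ having exactly $k$ bridges. Then \[ SO(\Gamma)\ \ge\ \begin{cases} \sqrt{8}\,n, & k=0,\\[1mm] 2(n-3)\sqrt{2}+\sqrt{10}+2\sqrt{13}, & k=1,\\[1mm] 2(n-4)\sqrt{2}+\sqrt{5}+3\sqrt{13}, & 2\le k\le n-3,\\[1mm] 2(n-3)\sqrt{2}+2\sqrt{5}, & k=n-1, \end{cases} \] with equality if and only if $\Gamma\cong \mathbb{P}_n^k$.
   Context: For a graph $\Gamma$, the Sombor index is $SO(\Gamma)=\sum_{uv\in E(\Gamma)}\sqrt{\deg_\Gamma(u)^2+\deg_\Gamma(v)^2}$. A bridge is an edge whose deletion disconnects the graph. For $0\le k\le n-3$, $\mathbb{P}_n^k$ denotes the graph obtained from the cycle $C_{n-k}$ by taking a vertex $u_1$ of the cycle and attaching a path on $k+1$ vertices to it (identifying one end vertex of the path with $u_1$), so that $k$ new vertices are added; thus $\mathbb{P}_n^0=C_n$. For $k=n-1$, $\mathbb{P}_n^{n-1}$ denotes the path $P_n$. *)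

(* Defs.v *)
From HB Require Import structures.
From mathcomp Require Import all_boot all_order all_algebra.
From mathcomp Require Import reals.

Set Implicit Arguments.
Unset Strict Implicit.
Unset Printing Implicit Defensive.

Import Order.TTheory GRing.Theory Num.Theory.
Local Open Scope ring_scope.

Record sgraph (T : finType) := SGraph {
  adj :> rel T;
  adj_sym : symmetric adj;
  adj_irr : irreflexive adj }.

Definition edges (T : finType) (G : sgraph T) : {set {set T}} :=
  [set [set p.1; p.2] | p : T * T & G p.1 p.2].

Definition deg (T : finType) (G : sgraph T) (x : T) : nat := #|[set y | G x y]|.

Definition gconnected (T : finType) (r : rel T) : bool :=
  [forall x, forall y, connect r x y].

Definition del_edge (T : finType) (G : sgraph T) (A : {set T}) : rel T :=
  [rel x y | G x y && ([set x; y] != A)].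

Definition bridges (T : finType) (G : sgraph T) : {set {set T}} :=
  [set A in edges G | ~~ gconnected (del_edge G A)].

(* An edge uv is the two-element set [set u; v] with u != v, so the inner sum
   is deg(u)^2 + deg(v)^2. *)
Definition Sombor (R : realType) (T : finType) (G : sgraph T) : R :=
  \sum_(A in edges G) Num.sqrt (\sum_(x in A) (deg G x)%:R ^+ 2).

Definition giso (T U : finType) (G : sgraph T) (H : sgraph U) : Prop :=
  exists2 f : T -> U, bijective f & forall x y, H (f x) (f y) = G x y.

(* P_n^k on the vertices 0, ..., n-1: the Hamiltonian path 0 - 1 - ... - (n-1)
   together with the chord {0, n-k-1}. The vertices 0, ..., n-k-1 then form
   the cycle C_(n-k), u_1 is n-k-1, and n-k-1, n-k, ..., n-1 is the attached
   path on k+1 vertices. For k = n-1 there is no chord, which leaves the path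
   P_n. *)
Definition pnk_arc (n k i j : nat) : bool :=
  (i.+1 == j) || [&& (2 < n - k)%N, i == 0%N & j == (n - k).-1].

Definition pnk_rel (n k : nat) : rel 'I_n :=
  [rel i j : 'I_n | pnk_arc n k i j || pnk_arc n k j i].

Fact pnk_sym n k : symmetric (@pnk_rel n k).
Proof. by move=> i j; rewrite /pnk_rel /= orbC. Qed.

Fact pnk_irr n k : irreflexive (@pnk_rel n k).
Proof.
move=> i; rewrite /pnk_rel /= orbb /pnk_arc gtn_eqF //=.
by case: (n - k)%N => [|[|[|m]]] //=; case: (i : nat).
Qed.

Definition pnk (n k : nat) : sgraph 'I_n := SGraph (@pnk_sym n k) (@pnk_irr n k).

Definition SO_bound (R : realType) (n k : nat) : R :=
  if k == 0%N then Num.sqrt 8 * n%:R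
  else if k == 1%N then
    2 * (n%:R - 3) * Num.sqrt 2 + Num.sqrt 10 + 2 * Num.sqrt 13
  else if (k + 3 <= n)%N then
    2 * (n%:R - 4) * Num.sqrt 2 + Num.sqrt 5 + 3 * Num.sqrt 13
  else (* k = n - 1 *)
    2 * (n%:R - 3) * Num.sqrt 2 + 2 * Num.sqrt 5.

(* Main.v *)
Require Import Defs.
From HB Require Import structures.
From mathcomp Require Import all_boot all_order all_algebra.
From mathcomp Require Import reals.
From mathcomp Require Import zify ring lra.

(* Give an edge whose ends have degrees i and j the weight
     gap i j = sqrt(i^2 + j^2) - alpha + beta (1/i + 1/j),
   with alpha and beta chosen so that gap 1 2 = gap 2 2 = 0. Since the sum of
   1/deg over all edge ends is n, a graph with n vertices and m edges satisfies
     SO = sqrt 8 n + alpha (m - n) + sum of the gaps,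
   where every gap is nonnegative, and at least gap 2 3 as soon as one end has
   degree >= 3. Four edges meeting vertices of degree >= 3, or m > n, already
   push SO above every bound with k <= n - 3, and m = n - 1 forces k = n - 1.
   The surviving graphs have maximum degree 2, or a single vertex of degree 3
   and m = n, hence a single leaf. In these a longest path starting at a leaf
   (anywhere, in a cycle) is Hamiltonian, which identifies them as some P_n^j;
   the number of bridges then gives j = k. *)

Set Implicit Arguments.
Unset Strict Implicit.
Unset Printing Implicit Defensive.

Import Order.TTheory GRing.Theory Num.Theory.
Local Open Scope ring_scope.

(** * Edges and degrees *)

Lemma edgesP (T : finType) (G : sgraph T) (A : {set T}) :
  reflect (exists x y, G x y /\ A = [set x; y]) (A \in edges G).
Proof.
apply: (iffP imsetP) => [[[x y] /= + ->]|[x [y [xy ->]]]].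
  by rewrite inE => xy; exists x, y.
by exists (x, y); rewrite ?inE.
Qed.

Lemma adj_neq (T : finType) (G : sgraph T) x y : G x y -> x != y.
Proof. by apply: contraTneq => ->; rewrite adj_irr. Qed.

Lemma mem_edges (T : finType) (G : sgraph T) x y :
  ([set x; y] \in edges G) = G x y.
Proof.
apply/edgesP/idP => [[a [b [ab E]]]|xy]; last by exists x, y.
have ax : a \in [set x; y] by rewrite E set21.
have bx : b \in [set x; y] by rewrite E set22.
move: (adj_neq ab) ax bx; rewrite !inE.
by move=> + /orP[]/eqP ea /orP[]/eqP eb; subst a b; rewrite ?eqxx // adj_sym.
Qed.

Lemma card_edge (T : finType) (G : sgraph T) A : A \in edges G -> #|A| = 2%N.
Proof. by case/edgesP => x [y [xy ->]]; rewrite cards2 (adj_neq xy). Qed.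

Lemma edge_at (T : finType) (G : sgraph T) A x :
  A \in edges G -> x \in A -> exists2 y, G x y & A = [set x; y].
Proof.
case/edgesP => a [b [ab ->]]; rewrite !inE => /orP[]/eqP ->; first by exists b.
by exists a; rewrite 1?adj_sym // setUC.
Qed.

Lemma set2_injr (T : finType) (x : T) : injective (fun y => [set x; y]).
Proof.
move=> y z E; have: y \in [set x; z] by rewrite -E set22.
have: z \in [set x; y] by rewrite E set22.
by rewrite !inE => /orP[]/eqP zE /orP[]/eqP yE; congruence.
Qed.

Definition star (T : finType) (G : sgraph T) (x : T) : {set {set T}} :=
  [set A in edges G | x \in A].

Lemma starE (T : finType) (G : sgraph T) x :
  star G x = [set [set x; y] | y in [set y | G x y]].
Proof.
apply/setP => A; rewrite inE; apply/andP/imsetP => [[AE xA]|[y]].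
  by have [y xy ->] := edge_at AE xA; exists y; rewrite ?inE.
by rewrite inE => xy ->; rewrite mem_edges set21.
Qed.

Lemma card_star (T : finType) (G : sgraph T) x : #|star G x| = deg G x.
Proof. by rewrite starE card_imset //; apply: set2_injr. Qed.

(** Swapping the two sums counts [F x] once for each edge at x. With 1/deg for [F], the right side
    becomes the number of vertices when no degree is 0. *)
Lemma sum_edges (V : nmodType) (T : finType) (G : sgraph T) (F : T -> V) :
  \sum_(A in edges G) \sum_(x in A) F x = \sum_x F x *+ deg G x.
Proof.
under [LHS]eq_bigr do rewrite big_mkcond /=.
rewrite exchange_big /=; apply: eq_bigr => x _.
by rewrite -big_mkcondr -card_star -sumr_const; apply: eq_bigl => A; rewrite inE.
Qed.

Lemma sum_deg (T : finType) (G : sgraph T) :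
  (\sum_x deg G x = #|edges G| * 2)%N.
Proof.
under eq_bigr do rewrite -card_star -sum1_card.
rewrite (exchange_big_dep (mem (edges G))) /=; last first.
  by move=> x A _; rewrite inE => /andP[].
rewrite -sum_nat_const; apply: eq_bigr => A AE.
rewrite -(card_edge AE) -sum1_card; apply: eq_bigl => x; by rewrite inE AE.
Qed.

(** * Connectivity, deletion of an edge and bridges *)

Lemma connect_stable (T : finType) (r : rel T) (S : {set T}) x y :
  (forall a b, a \in S -> r a b -> b \in S) -> x \in S -> connect r x y ->
  y \in S.
Proof.
move=> cl xS /connectP[p + ->]; elim: p x xS => //= a p IH x xS /andP[xa].
exact/IH/(cl _ _ xS).
Qed.

(** If no step of [r] left [S], everything reachable from x would lie in [S]. Connectivity is mostly
    used in this form. *)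
Lemma gconnected_exit (T : finType) (r : rel T) (S : {set T}) x y :
  gconnected r -> x \in S -> y \notin S ->
  exists a b, [/\ a \in S, b \notin S & r a b].
Proof.
move=> /forallP/(_ x)/forallP/(_ y) xy xS yS.
case: (boolP [exists a, exists b, [&& a \in S, b \notin S & r a b]]).
  by move=> /existsP[a /existsP[b /and3P[]]]; exists a, b.
rewrite negb_exists => /forallP H; case/negP: yS; apply: connect_stable xS xy.
move=> a b aS ab; move: (H a); rewrite negb_exists => /forallP/(_ b).
by rewrite aS ab andbT /= negbK.
Qed.

(** Grow a vertex set from a single vertex: some edge leaves it, and adding the far end of that edge
    brings in an edge that was not inside before. This yields a set of j + 1 vertices spanning at
    least j edges. *)
Lemma gconnected_card_edges (T : finType) (G : sgraph T) :
  gconnected G -> (#|T| <= #|edges G|.+1)%N.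
Proof.
move=> cG.
have H j : (j < #|T|)%N -> exists2 S : {set T}, #|S| = j.+1 &
    (j <= #|[set A in edges G | A \subset S]|)%N.
  elim: j => [|j IH] jT.
    by case/card_gt0P: jT => x _; exists [set x]; rewrite ?cards1.
  have [S cS le] := IH (ltnW jT).
  have [x xS] : exists x, x \in S by apply/card_gt0P; rewrite cS.
  have [y yS] : exists y, y \notin S.
    have : (0 < #|~: S|)%N by rewrite cardsCs setCK cS subn_gt0.
    by case/card_gt0P => y; rewrite inE; exists y.
  have [a [b [aS bS ab]]] := gconnected_exit cG xS yS.
  exists (b |: S); first by rewrite cardsU1 bS cS.
  have nin : [set a; b] \notin [set A in edges G | A \subset S].
    by rewrite inE negb_and subUset !sub1set (negbTE bS) andbF orbT.
  apply: leq_trans (_ : #|[set a; b] |: [set A in edges G | A \subset S]| <= _)%N.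
    by rewrite cardsU1 nin.
  apply/subset_leq_card/subsetP => A; rewrite !inE => /orP[/eqP->|/andP[AE AS]].
    by rewrite mem_edges ab subUset !sub1set !inE eqxx aS orbT.
  by rewrite AE (subset_trans AS) ?subsetUr.
case E : #|T| => [//|j]; have [|S _ le] := H j; first by rewrite E.
apply: leq_trans le _; apply/subset_leq_card/subsetP => A; by rewrite inE => /andP[].
Qed.

Lemma del_edge_sym (T : finType) (G : sgraph T) A : symmetric (del_edge G A).
Proof. by move=> x y; rewrite /del_edge /= adj_sym setUC. Qed.

Lemma del_edge_irr (T : finType) (G : sgraph T) A : irreflexive (del_edge G A).
Proof. by move=> x; rewrite /del_edge /= adj_irr. Qed.

Definition del_graph (T : finType) (G : sgraph T) A : sgraph T :=
  SGraph (@del_edge_sym T G A) (@del_edge_irr T G A).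

Lemma edges_del_graph (T : finType) (G : sgraph T) A :
  edges (del_graph G A) = edges G :\ A.
Proof.
apply/setP => B; apply/idP/idP.
  case/edgesP => x [y [/andP[xy ne] ->]]; by rewrite !inE ne mem_edges.
rewrite !inE => /andP[ne /edgesP[x [y [xy E]]]].
by rewrite E mem_edges /= /del_edge /= xy -E.
Qed.

(** After the loss of an edge at most |T| - 2 remain, too few for connectivity. *)
Lemma tree_bridges (T : finType) (G : sgraph T) :
  (#|edges G| < #|T|)%N -> bridges G = edges G.
Proof.
move=> lt; apply/setP => A; rewrite inE; case: (boolP (A \in edges G)) => //= AE.
apply/negP => /(@gconnected_card_edges _ (del_graph G A)).
rewrite edges_del_graph; have := cardsD1 A (edges G); rewrite AE add1n => <-.
by rewrite leqNgt lt.
Qed.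

Lemma deg_gt0 (T : finType) (G : sgraph T) x :
  gconnected G -> (1 < #|T|)%N -> (0 < deg G x)%N.
Proof.
move=> cG T1; have [y] : exists y, y \in ~: [set x].
  by apply/card_gt0P; rewrite cardsC1; lia.
rewrite inE => yx; have [a [b [/set1P-> _ xb]]] := gconnected_exit cG (set11 x) yx.
by apply/card_gt0P; exists b; rewrite inE.
Qed.

Lemma deg_ge (T : finType) (G : sgraph T) x (s : seq T) :
  uniq s -> all (G x) s -> (size s <= deg G x)%N.
Proof.
move=> us /allP As; rewrite -(card_uniqP us); apply/subset_leq_card/subsetP => y.
by rewrite inE => /As.
Qed.

(** Since there is a third vertex, some edge leaves {x, y}, and its end in {x, y} has degree at
    least 2. This rules out the degree pair 1, 1, the only one of negative gap. *)
Lemma adj_deg_gt2 (T : finType) (G : sgraph T) x y :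
  gconnected G -> (2 < #|T|)%N -> G x y -> (2 < deg G x + deg G y)%N.
Proof.
move=> cG T2 xy; have nxy := adj_neq xy.
have [z zS] : exists z, z \in ~: [set x; y].
  by apply/card_gt0P; rewrite cardsCs setCK cards2 nxy; lia.
rewrite inE in zS.
have [a [b [+ bS ab]]] := gconnected_exit cG (set21 x y) zS.
move: bS; rewrite !inE negb_or => /andP[bx b_y] /orP[]/eqP E; subst a.
  have : (2 <= deg G x)%N
    by apply: (@deg_ge _ _ _ [:: y; b]); rewrite /= ?inE 1?eq_sym ?b_y ?xy ?ab.
  by have := deg_gt0 y cG (ltnW T2); lia.
have : (2 <= deg G y)%N.
  apply: (@deg_ge _ _ _ [:: x; b]); rewrite /= ?inE 1?eq_sym ?bx //.
  by rewrite (adj_sym G y x) xy ab.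
by have := deg_gt0 x cG (ltnW T2); lia.
Qed.

(** * The gap of an edge *)

Lemma le_sqrt_of_sqr (R : realType) (q x : R) :
  0 <= q -> q ^+ 2 <= x -> q <= Num.sqrt x.
Proof.
move=> q0 qx; rewrite -(ger0_norm q0) -sqrtr_sqr ler_wsqrtr //.
Qed.

Lemma sqrt_le_of_sqr (R : realType) (q x : R) :
  0 <= q -> x <= q ^+ 2 -> Num.sqrt x <= q.
Proof.
move=> q0 qx; rewrite -[leRHS](ger0_norm q0) -sqrtr_sqr ler_wsqrtr //.
Qed.

(** Here and in the next three lemmas, the bounds on the root of d are continued fraction
    convergents p/q, or d q/p for such a convergent. *)
Lemma sqrt2_bounds (R : realType) : 140 / 99 <= Num.sqrt (2 : R) <= 99 / 70.
Proof. by apply/andP; split; [apply: le_sqrt_of_sqr | apply: sqrt_le_of_sqr]; lra. Qed.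

Lemma sqrt5_bounds (R : realType) : 38 / 17 <= Num.sqrt (5 : R) <= 161 / 72.
Proof. by apply/andP; split; [apply: le_sqrt_of_sqr | apply: sqrt_le_of_sqr]; lra. Qed.

Lemma sqrt10_bounds (R : realType) : 60 / 19 <= Num.sqrt (10 : R) <= 19 / 6.
Proof. by apply/andP; split; [apply: le_sqrt_of_sqr | apply: sqrt_le_of_sqr]; lra. Qed.

Lemma sqrt13_bounds (R : realType) : 18 / 5 <= Num.sqrt (13 : R) <= 119 / 33.
Proof. by apply/andP; split; [apply: le_sqrt_of_sqr | apply: sqrt_le_of_sqr]; lra. Qed.

Lemma sqrt8E (R : realType) : Num.sqrt 8 = 2 * Num.sqrt 2 :> R.
Proof.
have -> : 8 = 2 ^+ 2 * 2 :> R by lra.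
by rewrite sqrtrM ?sqrtr_sqr ?ger0_norm //; lra.
Qed.

(* The solution of alpha - beta = sqrt 8 and alpha - 3/2 beta = sqrt 5, that is,
   of gap 2 2 = gap 1 2 = 0. *)
Definition gap_alpha (R : realType) : R := 6 * Num.sqrt 2 - 2 * Num.sqrt 5.
Definition gap_beta (R : realType) : R := 4 * Num.sqrt 2 - 2 * Num.sqrt 5.

Definition gap (R : realType) (i j : nat) : R :=
  Num.sqrt (i%:R ^+ 2 + j%:R ^+ 2) - gap_alpha R +
  gap_beta R * (i%:R^-1 + j%:R^-1).

Lemma gapC (R : realType) i j : gap R i j = gap R j i.
Proof. by rewrite /gap addrC [X in Num.sqrt X]addrC [X in gap_beta R * X]addrC addrC. Qed.

(** This is the total gap of P_n^k for 2 <= k <= n - 3, whose vertex of degree 3 has three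
    neighbours of degree 2. *)
Lemma gap23E (R : realType) :
  3 * gap R 2 3 = 3 * Num.sqrt 13 - 8 * Num.sqrt 2 + Num.sqrt 5.
Proof.
rewrite /gap /gap_alpha /gap_beta.
by have -> : 2%:R ^+ 2 + 3%:R ^+ 2 = 13 :> R; [lra | field].
Qed.

(** This is the total gap of P_n^1: one of the three edges at the vertex of degree 3 ends in the
    leaf. *)
Lemma gap13E (R : realType) :
  gap R 1 3 + 2 * gap R 2 3 = Num.sqrt 10 + 2 * Num.sqrt 13 - 6 * Num.sqrt 2.
Proof.
rewrite /gap /gap_alpha /gap_beta.
have -> : 2%:R ^+ 2 + 3%:R ^+ 2 = 13 :> R by lra.
by have -> : 1%:R ^+ 2 + 3%:R ^+ 2 = 10 :> R; [lra | field].
Qed.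

Lemma gap12 (R : realType) : gap R 1 2 = 0.
Proof.
rewrite /gap /gap_alpha /gap_beta.
by have -> : 1%:R ^+ 2 + 2%:R ^+ 2 = 5 :> R; [lra | field].
Qed.

Lemma gap22 (R : realType) : gap R 2 2 = 0.
Proof.
rewrite /gap /gap_alpha /gap_beta.
have -> : 2%:R ^+ 2 + 2%:R ^+ 2 = 8 :> R by lra.
by rewrite sqrt8E; field.
Qed.

Lemma gap_le2 (R : realType) i j :
  (0 < i <= 2)%N -> (0 < j <= 2)%N -> (2 < i + j)%N -> gap R i j = 0.
Proof.
by case: i j => [|[|[|i]]] [|[|[|j]]] //= _ _ _; rewrite ?gap12 ?gap22 // gapC gap12.
Qed.

(** Compared with degrees 2 and 3, larger degrees gain more in the root than beta times the loss in
    the reciprocals. Only for degrees 1 and 3 is the root smaller; there the reciprocals make up for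
    it, as beta >= 11/10. *)
Lemma gap_ge3 (R : realType) i j :
  (0 < i)%N -> (2 < j)%N -> gap R 2 3 <= gap R i j.
Proof.
move=> i0 j2; rewrite /gap.
have /andP[? ?] := sqrt2_bounds R; have /andP[? ?] := sqrt5_bounds R.
have /andP[? ?] := sqrt13_bounds R.
have -> : 2%:R ^+ 2 + 3%:R ^+ 2 = 13 :> R by lra.
have be : 11 / 10 <= gap_beta R <= 12 / 10 by rewrite /gap_beta; lra.
have pa : 0 <= gap_beta R * i%:R^-1 by apply: mulr_ge0; rewrite ?invr_ge0 //; lra.
have pb : 0 <= gap_beta R * j%:R^-1 by apply: mulr_ge0; rewrite ?invr_ge0 //; lra.
rewrite !mulrDr; have sq (q m : nat) : (q <= m)%N -> q%:R ^+ 2 <= m%:R ^+ 2 :> R.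
  by move=> qm; rewrite -!natrX ler_nat leq_sqr.
have [j4|j3] := leqP 4 j.
  have j16 := sq _ _ j4.
  move: i0 pa; case: i => [|[|[|i]]] // _ pa.
  - have w : (4 : R) <= Num.sqrt (1%:R ^+ 2 + j%:R ^+ 2) by apply: le_sqrt_of_sqr; lra.
    lra.
  - have w : (22 / 5 : R) <= Num.sqrt (2%:R ^+ 2 + j%:R ^+ 2) by apply: le_sqrt_of_sqr; lra.
    lra.
  - have i9 := sq 3%N i.+3 isT.
    have w : (5 : R) <= Num.sqrt (i.+3%:R ^+ 2 + j%:R ^+ 2) by apply: le_sqrt_of_sqr; lra.
    generalize dependent i.+3 => m *; lra.
have {j2 j3}-> : j = 3%N by lia.
move: i0 pa; case: i => [|[|[|[|i]]]] // _ pa.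
- have w : (31 / 10 : R) <= Num.sqrt (1%:R ^+ 2 + 3%:R ^+ 2) by apply: le_sqrt_of_sqr; lra.
  lra.
- by have -> : 2%:R ^+ 2 + 3%:R ^+ 2 = 13 :> R by lra.
- have w : (21 / 5 : R) <= Num.sqrt (3%:R ^+ 2 + 3%:R ^+ 2) by apply: le_sqrt_of_sqr; lra.
  lra.
- have i9 := sq 4%N i.+4 isT.
  have w : (5 : R) <= Num.sqrt (i.+4%:R ^+ 2 + 3%:R ^+ 2) by apply: le_sqrt_of_sqr; lra.
  generalize dependent i.+4 => m *; lra.
Qed.

Definition edge_gap (R : realType) (T : finType) (G : sgraph T) (A : {set T}) : R :=
  Num.sqrt (\sum_(x in A) (deg G x)%:R ^+ 2) - gap_alpha R +
  gap_beta R * \sum_(x in A) (deg G x)%:R^-1.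

Lemma edge_gapE (R : realType) (T : finType) (G : sgraph T) x y :
  G x y -> edge_gap R G [set x; y] = gap R (deg G x) (deg G y).
Proof.
by move=> xy; rewrite /edge_gap !big_setU1 ?inE ?(adj_neq xy) //= !big_set1.
Qed.

(** As deg x times 1/deg x is 1, the reciprocals add up to |T| over all edge ends. The coefficient
    of |T| is then alpha - beta = 2 sqrt 2. *)
Lemma Sombor_gap (R : realType) (T : finType) (G : sgraph T) :
  (forall x, 0 < deg G x)%N ->
  Sombor R G = 2 * Num.sqrt 2 * #|T|%:R +
    gap_alpha R * (#|edges G|%:R - #|T|%:R) + \sum_(A in edges G) edge_gap R G A.
Proof.
move=> dpos.
have E : \sum_(A in edges G) edge_gap R G A =
    Sombor R G - gap_alpha R * #|edges G|%:R + gap_beta R * #|T|%:R.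
  rewrite /edge_gap big_split /= -mulr_sumr sum_edges big_split /= sumr_const mulNrn.
  congr (_ - _ + _ * _); first by rewrite mulr_natr.
  rewrite (eq_bigr (fun=> 1)) => [|x _]; first by rewrite sumr_const.
  by rewrite -[LHS]mulr_natr mulVf // pnatr_eq0 -lt0n.
rewrite E /gap_alpha /gap_beta; ring.
Qed.

(** * Isomorphism and the graphs P_n^k *)

Lemma imset_set2 (T U : finType) (f : T -> U) x y :
  f @: [set x; y] = [set f x; f y].
Proof. by rewrite imsetU !imset_set1. Qed.

Lemma giso_deg (T U : finType) (G : sgraph T) (H : sgraph U) (f : T -> U) x :
  bijective f -> (forall x y, H (f x) (f y) = G x y) -> deg H (f x) = deg G x.
Proof.
move=> [g fK gK] fG; rewrite /deg -(card_imset _ (can_inj fK)).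
apply: eq_card => z; rewrite inE; apply/idP/imsetP => [fz|[y]].
  by exists (g z); rewrite ?gK // inE -fG gK.
by rewrite inE -fG => xy ->.
Qed.

Lemma giso_edges (T U : finType) (G : sgraph T) (H : sgraph U) (f : T -> U) :
  bijective f -> (forall x y, H (f x) (f y) = G x y) ->
  edges H = [set f @: (A : {set T}) | A in edges G].
Proof.
move=> [g fK gK] fG; apply/setP => B; apply/edgesP/imsetP.
  move=> [x [y [xy ->]]]; exists [set g x; g y]; last by rewrite imset_set2 !gK.
  by rewrite mem_edges -fG !gK.
move=> [A /edgesP[x [y [xy ->]]] ->].
by exists (f x), (f y); rewrite imset_set2 fG.
Qed.

Lemma giso_Sombor (R : realType) (T U : finType) (G : sgraph T) (H : sgraph U) :
  giso G H -> Sombor R G = Sombor R H.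
Proof.
move=> [f fb fG]; have fI := bij_inj fb.
rewrite /Sombor (giso_edges fb fG) [RHS]big_imset /=; last first.
  by move=> A B _ _ /(imset_inj fI).
apply: eq_bigr => A _; rewrite [in RHS]big_imset /=; last by move=> x y _ _ /fI.
by congr Num.sqrt; apply: eq_bigr => x _; rewrite (giso_deg _ fb fG).
Qed.

Lemma connect_homo (T U : finType) (r : rel T) (r' : rel U) (f : T -> U) x y :
  {homo f : a b / r a b >-> r' a b} -> connect r x y -> connect r' (f x) (f y).
Proof.
move=> fr /connectP[p + ->]; elim: p x => //= a p IH x /andP[xa /IH].
exact/connect_trans/connect1/fr.
Qed.

Lemma gconnected_bij (T U : finType) (r : rel T) (r' : rel U) (f : T -> U) :
  bijective f -> (forall x y, r' (f x) (f y) = r x y) ->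
  gconnected r' = gconnected r.
Proof.
move=> [g fK gK] fr; apply/forallP/forallP => c x; apply/forallP => y.
  have /forallP/(_ (f y)) := c (f x); move/(connect_homo (f := g)(r' := r)).
  by rewrite !fK; apply => a b; rewrite -fr !gK.
have /forallP/(_ (g y)) := c (g x); move/(connect_homo (f := f)(r' := r')).
by rewrite !gK; apply => a b; rewrite fr.
Qed.

Lemma giso_bridges (T U : finType) (G : sgraph T) (H : sgraph U) :
  giso G H -> #|bridges G| = #|bridges H|.
Proof.
move=> [f fb fG]; have fI := bij_inj fb.
rewrite -(card_imset (bridges G) (imset_inj fI)); apply: eq_card => B.
rewrite inE (giso_edges fb fG).
have conE A : gconnected (del_edge H (f @: (A : {set T}))) = gconnected (del_edge G A).
  apply: (gconnected_bij fb) => x y.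
  by rewrite /del_edge /= fG -imset_set2 (inj_eq (imset_inj fI)).
apply/imsetP/andP => [[A + ->]|[/imsetP[A AE ->] nc]].
  by rewrite inE conE => /andP[AE nc]; split=> //; apply: imset_f.
by exists A; rewrite // inE AE -conE.
Qed.

(** * Degrees and bridges of P_n^k *)

Lemma set2_eq (T : finType) (x y a b : T) :
  [set x; y] = [set a; b] -> x = a /\ y = b \/ x = b /\ y = a.
Proof.
move=> E.
have : x \in [set a; b] by rewrite -E set21.
have : y \in [set a; b] by rewrite -E set22.
have : a \in [set x; y] by rewrite E set21.
have : b \in [set x; y] by rewrite E set22.
by rewrite !inE; do 4![case/orP=> /eqP ?]; subst; auto.
Qed.

Lemma degE (T : finType) (G : sgraph T) x : deg G x = (\sum_y G x y)%N.
Proof.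
rewrite /deg -sum1_card big_mkcond /=; apply: eq_bigr => y _.
by rewrite inE; case: (G x y).
Qed.

Lemma sum_ord_eq n a : (\sum_(j < n) (j == a :> nat) = (a < n))%N.
Proof.
case: ltnP => [an|na].
  rewrite (bigD1 (Ordinal an)) //= eqxx big1 // => j.
  by rewrite -val_eqE /= => /negbTE->.
by rewrite big1 // => j _; rewrite ltn_eqF // (leq_trans (ltn_ord j)).
Qed.

Lemma sum_ord_eqS n a : (a < n -> \sum_(j < n) (j.+1 == a :> nat) = (0 < a))%N.
Proof.
case: a => [|a] an; first by rewrite big1.
under eq_bigr do rewrite eqSS; by rewrite sum_ord_eq ltnW.
Qed.

Lemma del_edgeE (T : finType) (G : sgraph T) A x y :
  del_edge G A x y = G x y && ([set x; y] != A).
Proof. by []. Qed.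

Lemma pnkE n k i j : pnk n k i j = pnk_arc n k i j || pnk_arc n k j i.
Proof. by []. Qed.

(** The chord raises the degree of u_1 to 3 and the end of the path misses a successor. For k = 0
    these are the same vertex and the two corrections cancel. *)
Lemma deg_pnk n k (i : 'I_n) : (k + 3 <= n)%N ->
  (deg (pnk n k) i + (i == n.-1 :> nat) = 2 + (i == (n - k).-1 :> nat))%N.
Proof.
move=> kn; rewrite degE.
(* The four terms are mutually exclusive: j is the successor of i, its predecessor, or the other end
   of the chord, seen from 0 or from u_1. *)
have E (j : 'I_n) : nat_of_bool (pnk n k i j) =
    ((j == i.+1 :> nat) + (j.+1 == i) +
     ((i == 0 :> nat) * (j == (n - k).-1 :> nat) +
      (i == (n - k).-1 :> nat) * (j == 0 :> nat)))%N.
  rewrite pnkE /pnk_arc; have -> : (2 < n - k)%N by lia.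
  have : (2 <= (n - k).-1)%N by lia.
  by move: (n - k).-1 (i : nat) (j : nat) => c a b /=; lia.
under eq_bigr do rewrite E.
rewrite !big_split /= -!big_distrr /= !sum_ord_eq sum_ord_eqS //.
have := ltn_ord i; lia.
Qed.

Lemma deg_pnk_path n (i : 'I_n) : (2 <= n)%N ->
  (deg (pnk n n.-1) i + (i == n.-1 :> nat) + (i == 0 :> nat) = 2)%N.
Proof.
move=> kn; rewrite degE.
have E (j : 'I_n) : nat_of_bool (pnk n n.-1 i j) =
    ((j == i.+1 :> nat) + (j.+1 == i))%N.
  by rewrite pnkE /pnk_arc; move: (i : nat) (j : nat) => a b; lia.
under eq_bigr do rewrite E.
rewrite !big_split /= !sum_ord_eq sum_ord_eqS //.
have := ltn_ord i; lia.
Qed.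

Lemma connect_segment n (r : rel 'I_n) (i j : 'I_n) :
  (forall x y : 'I_n, i <= x -> y = x.+1 :> nat -> y <= j -> r x y)%N ->
  (i <= j)%N -> connect r i j.
Proof.
case: j => j; elim: j => [|j IH] jn H ij.
  have -> : i = Ordinal jn by apply/val_inj => /=; move: ij => /=; lia.
  exact: connect0.
move: ij; rewrite leq_eqVlt => /orP[/eqP ij|ij].
  have -> : i = Ordinal jn by exact: val_inj.
  exact: connect0.
apply: (@connect_trans _ _ (Ordinal (ltnW jn))).
  by apply: IH => // x y ix yx yj; apply: H => //; apply: leq_trans yj _ => /=.
exact/connect1/H.
Qed.

Lemma gconnected_from (T : finType) (r : rel T) z :
  symmetric r -> (forall x, connect r z x) -> gconnected r.
Proof.
move=> rs zr; apply/forallP => x; apply/forallP => y.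
by apply: connect_trans (zr y); rewrite (sym_connect_sym rs).
Qed.

Lemma gconnected_pnk n k : gconnected (pnk n k).
Proof.
case: n => [|n]; first by apply/forallP => -[].
apply: (@gconnected_from _ _ ord0); first exact: adj_sym.
move=> x; apply: connect_segment => // a b _ E _.
by rewrite pnkE /pnk_arc E eqxx.
Qed.

(** The bridges are exactly the k edges {c + t, c + t + 1} of the attached path, where c is the
    vertex u_1. *)
Lemma card_bridges_pnk n k : (k + 3 <= n)%N -> #|bridges (pnk n k)| = k.
Proof.
case: n => [|n] kn; first by move: kn; lia.
have [c [cE c2]] : exists c, (c + k = n)%N /\ (2 <= c)%N by exists (n - k)%N; lia.
pose E (t : 'I_k) : {set 'I_n.+1} := [set inord (c + t); inord (c + t).+1].
have Ev (t : 'I_k) : (inord (c + t) : 'I_n.+1) = (c + t)%N :> nat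
    /\ (inord (c + t).+1 : 'I_n.+1) = (c + t).+1 :> nat.
  by have tk := ltn_ord t; rewrite !inordK //; lia.
have EI : injective E.
  move=> s t /set2_eq; have [s1 s2] := Ev s; have [t1 t2] := Ev t.
  move=> H; apply/val_inj => /=.
  case: H => -[/(congr1 val) /= h1 /(congr1 val) /= h2]; lia.
rewrite -[RHS]card_ord -cardsT -(card_imset _ EI); apply: eq_card => A.
rewrite inE; apply/andP/imsetP => [[/edgesP[x [y [+ ->]]]]|[t _ ->]].
  wlog xy : x y / pnk_arc n.+1 k x y.
    move=> W /orP[] xy nc; first by apply: W => //; rewrite pnkE xy.
    by rewrite setUC in nc *; apply: W => //; rewrite pnkE xy.
  move=> _ nc; case: (leqP c x) => cx.
    have xk : (x - c < k)%N by have := ltn_ord y; move: xy; rewrite /pnk_arc; lia.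
    exists (Ordinal xk) => //; have [e1 e2] := Ev (Ordinal xk).
    congr [set _; _]; apply/ord_inj; rewrite ?e1 ?e2 /=; move: xy; rewrite /pnk_arc; lia.
  case/negP: nc; have cn : (c < n.+1)%N by lia.

  pose z := Ordinal cn.
  have step (a b : 'I_n.+1) : b = a.+1 :> nat -> (a != x :> nat) || (b != y :> nat) ->
     (a != y :> nat) || (b != x :> nat) -> del_edge (pnk n.+1 k) [set x; y] a b.
    move=> ba n1 n2; rewrite del_edgeE pnkE /pnk_arc ba eqxx /=.
    by apply/eqP => /set2_eq[][e1 e2]; move: n1 n2; rewrite e1 e2 !eqxx.
  have symd := @del_edge_sym _ (pnk n.+1 k) [set x; y].
  (* The edge {x, x + 1} with x < c lies on the cycle. Without it, c still reaches the vertices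
     beyond x along the path, and the others through the chord to 0. *)
  have [xy1|xy1] := eqVneq (y : nat) x.+1.
    have right (a b : 'I_n.+1) : (x < a)%N -> (a <= b)%N ->
        connect (del_edge (pnk n.+1 k) [set x; y]) a b.
      move=> xa ab; apply: connect_segment => // u v au vu _; apply: step => //; lia.
    apply: (@gconnected_from _ _ z) => // v.
    case: (leqP v x) => vx; last first.
      case: (leqP v c) => vc; last by apply: right => //=; lia.
      by rewrite (sym_connect_sym symd); apply: right.
    apply: (@connect_trans _ _ ord0).
      apply: connect1; rewrite del_edgeE.
      apply/andP; split; first by rewrite pnkE /pnk_arc /=; lia.
      apply/eqP => /set2_eq[][/(congr1 val) /= h1 /(congr1 val) /= h2]; lia.
    apply: connect_segment => // u w _ wu wv; apply: step => //; lia.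
  (* The deleted edge is the chord, so the Hamiltonian path survives. *)
  apply: (@gconnected_from _ _ ord0) => // v.
  apply: connect_segment => // u w _ wu _; apply: step => //; move: xy; rewrite /pnk_arc; lia.
have [e1 e2] := Ev t; split.
  by rewrite mem_edges pnkE /pnk_arc e1 e2 eqxx.
apply/negP => /forallP/(_ (inord (c + t)))/forallP/(_ (inord (c + t).+1)).
(* No remaining edge leaves {0, ..., c + t}: the chord has both ends, 0 and c, inside. *)
move/(connect_stable (S := [set x : 'I_n.+1 | (x <= c + t)%N])).
rewrite !inE e1 e2 leqnn ltnn => H; suff : false by []; apply: H => // a b.
rewrite !inE => ale /andP[ab /eqP ne]; rewrite leqNgt; apply/negP => bt.
have bE : b = a.+1 :> nat by move: ab; rewrite pnkE /pnk_arc ; lia.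
apply: ne; congr [set _; _]; apply/ord_inj; rewrite ?e1 ?e2 /=; lia.
Qed.

(** * Recognising P_n^k *)

(* The 2 counts the predecessor and the successor of the [i]-th vertex on the
   path; for [i = 0] the indicator of [a] makes up for the missing one. *)
Lemma path_excess (T : finType) (G : sgraph T) a (p : seq T) i (ys : seq T) :
  path G a p -> uniq (a :: p) -> (i < size p)%N -> uniq ys ->
  (forall y, y \in ys -> G (nth a (a :: p) i) y /\ y \notin take i.+2 (a :: p)) ->
  (size ys + 2 <= deg G (nth a (a :: p) i) + (nth a (a :: p) i == a))%N.
Proof.
move=> /(pathP a) pG us ip uy ysP.
have mem_take j : (j <= i.+1)%N -> nth a (a :: p) j \in take i.+2 (a :: p).
  move=> ji; rewrite -(@nth_take i.+2) //; apply: mem_nth.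
  by rewrite size_take /=; case: ifP; lia.
have nin j : (j <= i.+1)%N -> nth a (a :: p) j \notin ys.
  by move=> /mem_take jt; apply/negP => /ysP[_]; rewrite jt.
have succ : G (nth a (a :: p) i) (nth a (a :: p) i.+1) by exact: pG.
have ysG : all (G (nth a (a :: p) i)) ys by apply/allP => y /ysP[].
case: i => [|i] in ip ysP mem_take nin succ ysG *.
  rewrite /= eqxx addn2 addn1 ltnS.
  apply: (@deg_ge _ _ _ (nth a (a :: p) 1 :: ys)); rewrite /= ?uy ?andbT.
    exact: (nin 1%N).
  by rewrite ysG andbT.
apply: leq_trans (leq_addr _ _); rewrite addn2.
apply: (@deg_ge _ _ _ (nth a (a :: p) i :: nth a (a :: p) i.+2 :: ys)).
  rewrite 2!cons_uniq uy nin // in_cons negb_or nin ?(leqW (leqnSn i)) // !andbT.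
  by rewrite nth_uniq //=; lia.
rewrite [all _ _]/=; rewrite succ ysG !andbT adj_sym; apply: pG; exact: ltnW.
Qed.

Lemma nth_notin_take (T : eqType) (a : T) (s : seq T) i j :
  uniq s -> (j < size s)%N -> (i <= j)%N -> nth a s j \notin take i s.
Proof. by move=> us js ij; rewrite in_take ?mem_nth // index_uniq // -leqNgt. Qed.

Lemma other_nbr (T : finType) (G : sgraph T) x z :
  (2 <= deg G x)%N -> exists2 y, G x y & y != z.
Proof.
move=> d2; have : (0 < #|[set y | G x y] :\ z|)%N.
  by move: d2; rewrite /deg (cardsD1 z); case: (_ \in _); lia.
by case/card_gt0P => y; rewrite !inE => /andP[yz xy]; exists y.
Qed.

(** Simple paths from [a] have bounded length, and a neighbour of the last vertex off a longest one
    would extend it. *)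
Lemma longest_path (T : finType) (r : rel T) (a : T) :
  exists p, [/\ path r a p, uniq (a :: p) &
    forall x, r (last a p) x -> x \in a :: p].
Proof.
pose P m := [exists t : m.-tuple T, path r a t && uniq (a :: t)].
have exP : exists m, P m by exists 0%N; apply/existsP; exists [tuple].
have boundP m : P m -> (m <= #|T|)%N.
  move=> /existsP[t /andP[_ /= /andP[_ ut]]].
  by rewrite -(size_tuple t) -(card_uniqP ut) max_card.
case: (ex_maxnP exP boundP) => m /existsP[t /andP[pt ut]] mmax.
exists t; split=> // x rx; apply: contraT => xt.
have /mmax : P m.+1.
  apply/existsP; exists [tuple of rcons t x]; rewrite [tval _]/=.
  by rewrite rcons_path pt rx -rcons_cons rcons_uniq xt.
by rewrite ltnn.
Qed.

(* [a] is a leaf and [U] the vertex of degree 3, if any; a cycle is covered by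
   taking any vertex for both. *)
Lemma hamiltonian_path (T : finType) (G : sgraph T) (a : T) (U : option T) :
  gconnected G ->
  (forall x, deg G x + (x == a) <= 2 + (U == Some x))%N ->
  (U -> forall x, x != a -> 2 <= deg G x)%N ->
  exists p, [/\ path G a p, uniq (a :: p) & forall x, x \in a :: p].
Proof.
move=> cG H1 H2; have [p [pG us pmax]] := longest_path G a.
exists p; split=> // x0; apply: contraT => x0s.
have [||v [x [vs xs vx]]] := @gconnected_exit _ _ [set x in a :: p] a x0 cG.
- by rewrite inE mem_head.
- by rewrite inE.
rewrite inE in vs; rewrite inE in xs.
have vE : nth a (a :: p) (index v (a :: p)) = v by exact: nth_index.
have: (index v (a :: p) < size (a :: p))%N by rewrite index_mem.
move: (index v (a :: p)) vE => i vE; rewrite /= ltnS leq_eqVlt.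
have lastE : last a p = nth a (a :: p) (size p) by rewrite -(last_nth a).
case/orP => [/eqP il|ip].
  by case/negP: xs; apply: pmax; rewrite lastE -il vE.
have xt : x \notin take i.+2 (a :: p) by apply: contra xs; apply: mem_take.
(* The edge from v to x leaves the path, so x is a neighbour of v besides those along the path; only
   the vertex in [U] has room for it. *)
have UE : U = Some v.
  have := @path_excess _ G a p i [:: x] pG us ip isT.
  rewrite vE => /(_ _)/leq_trans/(_ (H1 v)) /=.
  case: (U =P Some v) => // _ W; suff : (3 <= 2)%N by [].
  by apply: W => y; rewrite inE => /eqP ->.
have la : last a p != a.
  rewrite lastE; apply/eqP => E; have := nth_uniq a (i := size p) (j := 0) _ _ us.
  by rewrite /= ltnSn E eqxx; case: (size p) ip => // q _ /(_ isT isT).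
(* The last vertex is not [a], so it has a neighbour y other than its predecessor; by maximality y
   lies on the path. *)
have [|y ly ny] := @other_nbr _ G (last a p) (nth a (a :: p) (size p).-1).
  by apply: H2; rewrite ?UE.
have ys := pmax _ ly.
have yE : nth a (a :: p) (index y (a :: p)) = y by exact: nth_index.
have: (index y (a :: p) < size (a :: p))%N by rewrite index_mem.
move: (index y (a :: p)) yE => j yE; rewrite /= ltnS => jp.
have jl : (j.+1 < size p)%N.
  have : j != size p by apply: contraTneq ly => jE; rewrite lastE -yE jE adj_irr.
  have : j != (size p).-1 by apply: contraNneq ny => jE; rewrite -yE jE.
  by move: jp ip; lia.
have lt m : (m.+1 < size p)%N -> last a p \notin take m.+2 (a :: p).
  by move=> mp; rewrite lastE; apply: nth_notin_take.
(* The last vertex is an extra neighbour of y, so y too must be the vertex in [U]. *)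
have yv : y = v.
  have := @path_excess _ G a p j [:: last a p] pG us (ltnW jl) isT.
  rewrite yE => /(_ _)/leq_trans/(_ (H1 y)) /=.
  case: (U =P Some y) => [|_ W]; first by rewrite UE => -[].
  suff : (3 <= 2)%N by [].
  by apply: W => z; rewrite inE => /eqP ->; rewrite adj_sym ly lt.
have ij : i = j.
  by apply/eqP; rewrite -(nth_uniq a _ _ us) ?ltnS ?vE ?yE ?yv //=; apply: ltnW.
(* Now v has two extra neighbours, x and the last vertex, one more than its degree allows. *)
have := @path_excess _ G a p i [:: x; last a p] pG us ip.
rewrite vE => /(_ _ _)/leq_trans/(_ (H1 v)); rewrite UE eqxx /= inE andbT.
move=> W; suff : (4 <= 3)%N by []; apply: W.
  by apply: contraNneq xs => ->; apply: mem_last.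
move=> z; rewrite !inE => /orP[]/eqP -> //.
by rewrite -{1}yv adj_sym ly lt // ij.
Qed.

(** The given path starts at the leaf, which is n - 1 in P_n^k, so the isomorphism reverses it:
    position i goes to n - 1 - i, and the chord {k, n - 1} to {n - k - 1, 0}. *)
Lemma giso_pnk_of_path (T : finType) (G : sgraph T) n k a (p : seq T) :
  #|T| = n -> (k < n)%N -> uniq (a :: p) -> (forall x, x \in a :: p) ->
  (forall i j, i < j < n -> G (nth a (a :: p) i) (nth a (a :: p) j) =
     (j == i.+1) || [&& k + 3 <= n, i == k & j == n.-1])%N ->
  giso G (pnk n k).
Proof.
move=> Tn kn us ap GE.
have sn : size (a :: p) = n.
  by rewrite -Tn -(card_uniqP us); apply: eq_card => x; rewrite ap.
have ix x : (index x (a :: p) < n)%N by rewrite -sn index_mem.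
pose f x : 'I_n := rev_ord (Ordinal (ix x)).
have fI : injective f.
  move=> x y /rev_ord_inj/(congr1 val) /= E.
  by rewrite -(nth_index a (ap x)) -(nth_index a (ap y)) /= E.
exists f; first by apply: inj_card_bij fI _; rewrite card_ord Tn.
have pE i j : (i < j < n)%N ->
    pnk_arc n k (n - i.+1) (n - j.+1) || pnk_arc n k (n - j.+1) (n - i.+1) =
    (j == i.+1) || [&& (k + 3 <= n)%N, i == k & j == n.-1].
  by rewrite /pnk_arc; lia.
have fE x : f x = (n - (index x (a :: p)).+1)%N :> nat by [].
move=> x y; rewrite pnkE !fE.
have := ix x; have := ix y.
have -> : G x y = G (nth a (a :: p) (index x (a :: p))) (nth a (a :: p) (index y (a :: p))).
  by rewrite !nth_index.
move: (index x _) (index y _) => i j jn im; case: (ltngtP i j) => [ij|ij|->].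
- by rewrite GE ?pE ?ij ?jn.
- by rewrite adj_sym GE 1?orbC ?pE ?ij ?im.
by rewrite adj_irr orbb -[RHS](pnk_irr k (rev_ord (Ordinal jn))) /pnk_rel /= orbb.
Qed.

Lemma nth_path_adj (T : finType) (G : sgraph T) a (p : seq T) i :
  path G a p -> (i < size p)%N -> G (nth a (a :: p) i) (nth a (a :: p) i.+1).
Proof. by move=> /(pathP a) + ip => /(_ i ip). Qed.

(** An edge off the Hamiltonian path would give its earlier end one neighbour too many. *)
Lemma giso_path (T : finType) (G : sgraph T) n a :
  gconnected G -> #|T| = n -> (forall x, deg G x + (x == a) <= 2)%N ->
  giso G (pnk n n.-1).
Proof.
move=> cG Tn H1; have [||p [pG us ap]] := @hamiltonian_path _ G a None cG => //.
have sn : (size p).+1 = n.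
  by rewrite -[LHS]/(size (a :: p)) -Tn -(card_uniqP us); apply: eq_card => x; rewrite ap.
apply: (giso_pnk_of_path Tn _ us ap) => [|i j /andP[ij jn]]; first by rewrite -sn.
have -> : (n.-1 + 3 <= n)%N = false by lia.
rewrite orbF; have [->|ne] := eqVneq j i.+1.
  by apply: nth_path_adj => //; lia.
apply/negbTE/negP => ijG.
have := @path_excess _ G a p i [:: nth a (a :: p) j] pG us _ isT.
move=> /(_ _ _)/leq_trans/(_ (H1 _)) W; suff : (3 <= 2)%N by []; apply: W; first lia.
by move=> y; rewrite inE => /eqP->; split=> //; apply: nth_notin_take => //=; lia.
Qed.

(** The last vertex of a Hamiltonian path from [a] has a second neighbour, at position k, which
    supplies the chord. The degree bounds leave room for no other chord. *)
Lemma giso_unicyclic (T : finType) (G : sgraph T) n a u :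
  gconnected G -> #|T| = n -> (1 < n)%N ->
  (forall x, deg G x + (x == a) <= 2 + (x == u))%N ->
  (forall x, x != a -> 2 <= deg G x)%N ->
  exists2 k, (k + 3 <= n)%N & giso G (pnk n k).
Proof.
move=> cG Tn n1 H1 H2.
have [x||p [pG us ap]] := @hamiltonian_path _ G a (Some u) cG => //.
  by apply: leq_trans (H1 x) _; rewrite eq_sym.
have sn : (size p).+1 = n.
  by rewrite -[LHS]/(size (a :: p)) -Tn -(card_uniqP us); apply: eq_card => x; rewrite ap.
have [|y ly ny] := @other_nbr _ G (nth a (a :: p) n.-1) (nth a (a :: p) n.-2).
  apply: H2; apply/eqP => E.
  suff : n.-1 == 0%N by lia.
  by rewrite -(nth_uniq a _ _ us) ?E //=; lia.
have yE : nth a (a :: p) (index y (a :: p)) = y by exact: nth_index.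
have: (index y (a :: p) < n)%N by rewrite -sn index_mem.
move: (index y (a :: p)) yE => k yE kn.
have k3 : (k + 3 <= n)%N.
  have : k != n.-1 by apply: contraTneq ly => kE; rewrite -yE kE adj_irr.
  have : k != n.-2 by apply: contraNneq ny => kE; rewrite -yE kE.
  by lia.
(* The earlier end of any chord has a neighbour beyond its path neighbours, so it is [u]. *)
have ext i j : (i.+1 < j < n)%N -> G (nth a (a :: p) i) (nth a (a :: p) j) ->
    nth a (a :: p) i = u.
  move=> ijn ijG; have := @path_excess _ G a p i [:: nth a (a :: p) j] pG us _ isT.
  move=> /(_ _ _)/leq_trans/(_ (H1 _)).
  case: (_ =P u) => // _ W; suff : (3 <= 2)%N by []; apply: W; first lia.
  by move=> z; rewrite inE => /eqP->; split=> //; apply: nth_notin_take => //=; lia.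
exists k => //; apply: (giso_pnk_of_path Tn _ us ap) => [|i j /andP[ij jn]]; first lia.
have kG : G (nth a (a :: p) k) (nth a (a :: p) n.-1) by rewrite yE adj_sym.
have ku : nth a (a :: p) k = u by apply: ext kG; lia.
rewrite k3 /=; have [->|ne] := eqVneq j i.+1; first by apply: nth_path_adj => //; lia.
apply/idP/andP => [ijG|[/eqP-> /eqP->] //].
have iu : nth a (a :: p) i = u by apply: ext ijG; lia.
have ik : i = k.
  by apply/eqP; rewrite -(nth_uniq a _ _ us) ?iu ?ku //=; lia.
split; first exact/eqP.
(* A chord ending before the last vertex would be a second chord at [u], which has room for one. *)
apply/negPn/negP => jl; subst k.
have := @path_excess _ G a p i [:: nth a (a :: p) j; nth a (a :: p) n.-1] pG us.
move=> /(_ _ _ _)/leq_trans/(_ (H1 _)); rewrite iu eqxx => W.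
suff : (4 <= 3)%N by []; apply: W; first lia.
  by rewrite /= inE andbT nth_uniq //=; lia.
by move=> z; rewrite in_cons mem_seq1 => /orP[]/eqP->;
  rewrite -iu; split=> //; apply: nth_notin_take => //=; lia.
Qed.

(** * The bound *)

Lemma gap23_gt0 (R : realType) : 0 < gap R 2 3.
Proof.
have := gap23E R; have /andP[? ?] := sqrt2_bounds R.
have /andP[? ?] := sqrt5_bounds R; have /andP[? ?] := sqrt13_bounds R; lra.
Qed.

Lemma edge_gap_eq0 (R : realType) (T : finType) (G : sgraph T) A :
  gconnected G -> (2 < #|T|)%N -> A \in edges G ->
  (forall x, x \in A -> deg G x <= 2)%N -> edge_gap R G A = 0.
Proof.
move=> cG T2 /edgesP[x [y [xy ->]]] le2; rewrite edge_gapE //.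
by apply: gap_le2 (adj_deg_gt2 cG T2 xy); rewrite deg_gt0 ?le2 ?inE ?eqxx ?orbT //; apply: ltnW.
Qed.

Lemma edge_gap_ge (R : realType) (T : finType) (G : sgraph T) A x :
  gconnected G -> (1 < #|T|)%N -> A \in edges G -> x \in A ->
  (2 < deg G x)%N -> gap R 2 3 <= edge_gap R G A.
Proof.
move=> cG T1 AE xA d3; have [y xy ->] := edge_at AE xA.
by rewrite edge_gapE // [leRHS]gapC gap_ge3 // deg_gt0.
Qed.

Lemma edge_gap_ge0 (R : realType) (T : finType) (G : sgraph T) A :
  gconnected G -> (2 < #|T|)%N -> A \in edges G -> 0 <= edge_gap R G A.
Proof.
move=> cG T2 AE; case: (boolP [exists x in A, 2 < deg G x]%N).
  case/existsP => x /andP[xA d3].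
  exact: le_trans (ltW (gap23_gt0 R)) (edge_gap_ge R cG (ltnW T2) AE xA d3).
move=> /exists_inPn H; rewrite edge_gap_eq0 // => x /H; by rewrite -leqNgt.
Qed.

Lemma sum_edge_gap_ge (R : realType) (T : finType) (G : sgraph T) (S : {set {set T}}) :
  gconnected G -> (2 < #|T|)%N -> S \subset edges G ->
  (forall A, A \in S -> exists2 x, x \in A & 2 < deg G x)%N ->
  #|S|%:R * gap R 2 3 <= \sum_(A in edges G) edge_gap R G A.
Proof.
move=> cG T2 SE SP; rewrite mulr_natl -sumr_const.
rewrite [leRHS](big_setID S) /= (setIidPr SE) -[leLHS]addr0; apply: lerD.
  apply: ler_sum => A AS; have [x xA d3] := SP _ AS.
  exact: edge_gap_ge cG (ltnW T2) (subsetP SE _ AS) xA d3.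
apply: sumr_ge0 => A; rewrite inE => /andP[_ AE]; exact: edge_gap_ge0.
Qed.

Lemma sum_edge_gap_ge0 (R : realType) (T : finType) (G : sgraph T) :
  gconnected G -> (2 < #|T|)%N -> 0 <= \sum_(A in edges G) edge_gap R G A.
Proof. by move=> cG T2; apply: sumr_ge0 => A AE; apply: edge_gap_ge0. Qed.

Lemma star_sub (T : finType) (G : sgraph T) u : star G u \subset edges G.
Proof. by apply/subsetP => A; rewrite inE => /andP[]. Qed.

(** Each edge at a vertex of degree at least 3 has gap at least [gap R 2 3]. Two such vertices share
    at most one edge, so together they meet at least 3 + 3 - 1 edges. *)
Lemma deg_gap_cases (R : realType) (T : finType) (G : sgraph T) :
  gconnected G -> (2 < #|T|)%N ->
  [\/ forall x, (deg G x <= 2)%N,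
      exists u, [/\ deg G u = 3%N, forall x, x != u -> (deg G x <= 2)%N &
        3 * gap R 2 3 <= \sum_(A in edges G) edge_gap R G A]
    | 4 * gap R 2 3 <= \sum_(A in edges G) edge_gap R G A].
Proof.
move=> cG T2; have g0 := ltW (gap23_gt0 R).
case: (boolP [forall x, deg G x <= 2]%N) => [/forallP|]; first by constructor 1.
rewrite negb_forall => /existsP[u]; rewrite -ltnNge => du.
have su := @sum_edge_gap_ge R _ _ (star G u) cG T2 (star_sub G u).
have {}su : (deg G u)%:R * gap R 2 3 <= \sum_(A in edges G) edge_gap R G A.
  by rewrite -card_star; apply: su => A; rewrite inE => /andP[_ uA]; exists u.
have [d4|d3] := leqP 4 (deg G u).
  constructor 3; apply: le_trans su; apply: ler_wpM2r => //.
  by rewrite ler_nat.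
have {d3}du3 : deg G u = 3%N by lia.
case: (boolP [forall (x | x != u), deg G x <= 2]%N) => [/forall_inP H|].
  by constructor 2; exists u; split=> //; rewrite du3 in su.
case/forall_inPn => v; rewrite -?ltnNge => vu dv.
constructor 3; apply: le_trans (_ : #|star G u :|: star G v|%:R * gap R 2 3 <= _).
  apply: ler_wpM2r => //; rewrite ler_nat cardsU !card_star.
  have : (#|star G u :&: star G v| <= 1)%N.
    rewrite -(cards1 [set u; v]); apply/subset_leq_card/subsetP => A.
    rewrite !inE => /andP[/andP[AE uA] /andP[_ vA]].
    by have [y uy AE'] := edge_at AE uA; move: vA; rewrite AE' !inE (negbTE vu) /= => /eqP->.
  by move: du3 dv; rewrite /=; lia.
apply: sum_edge_gap_ge => //; first by rewrite subUset !star_sub.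
by move=> A; rewrite !inE => /orP[]/andP[_ ?]; [exists u|exists v].
Qed.

(** Edges that miss [u] have both ends of degree at most 2, hence gap 0. *)
Lemma sum_edge_gap_star (R : realType) (T : finType) (G : sgraph T) u :
  gconnected G -> (2 < #|T|)%N -> (forall x, x != u -> deg G x <= 2)%N ->
  \sum_(A in edges G) edge_gap R G A =
  \sum_(y in [set y | G u y]) gap R (deg G u) (deg G y).
Proof.
move=> cG T2 le2; rewrite (big_setID (star G u)) /= (setIidPr (star_sub G u)).
rewrite [X in _ + X]big1 ?addr0.
  rewrite starE big_imset /=; last by move=> y z _ _; apply: set2_injr.
  by apply: eq_bigr => y; rewrite inE => uy; rewrite edge_gapE.
move=> A; rewrite !inE => /andP[+ AE]; rewrite AE /= => uA.
by apply: edge_gap_eq0 => // x xA; apply: le2; apply: contraNneq uA => <-.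
Qed.

(** * The Sombor index of P_n^k *)

Lemma card_edges_pnk n k : (k + 3 <= n)%N -> #|edges (pnk n k)| = n.
Proof.
move=> kn.
have : (\sum_(i < n) (deg (pnk n k) i + (i == n.-1 :> nat)) =
        \sum_(i < n) (2 + (i == (n - k).-1 :> nat)))%N.
  by apply: eq_bigr => i _; rewrite deg_pnk.
rewrite !big_split /= sum_deg !sum_ord_eq sum_nat_const card_ord.
by move: #|edges _| => m; lia.
Qed.

Lemma card_edges_pnk_path n : (2 <= n)%N -> #|edges (pnk n n.-1)|.+1 = n.
Proof.
move=> n2.
have : (\sum_(i < n) (deg (pnk n n.-1) i + (i == n.-1 :> nat) + (i == 0 :> nat)) =
        \sum_(i < n) 2)%N.
  by apply: eq_bigr => i _; rewrite deg_pnk_path.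
rewrite !big_split /= sum_deg !sum_ord_eq sum_nat_const card_ord.
by move: #|edges _| => m; lia.
Qed.

(** This and the next three lemmas bring the bounds into the form of [Sombor_gap], with m = n, or m
    = n - 1 for the path. *)
Lemma SO_bound0 (R : realType) n : SO_bound R n 0 = 2 * Num.sqrt 2 * n%:R.
Proof. by rewrite /SO_bound /= sqrt8E. Qed.

Lemma SO_bound1 (R : realType) n :
  SO_bound R n 1 = 2 * Num.sqrt 2 * n%:R + (gap R 1 3 + 2 * gap R 2 3).
Proof. rewrite /SO_bound /= gap13E; ring. Qed.

Lemma SO_bound_mid (R : realType) n k : (1 < k)%N -> (k + 3 <= n)%N ->
  SO_bound R n k = 2 * Num.sqrt 2 * n%:R + 3 * gap R 2 3.
Proof.
by case: k => [|[|k]] // _ kn; rewrite /SO_bound /= kn gap23E; ring.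
Qed.

Lemma SO_bound_path (R : realType) n : (2 < n)%N ->
  SO_bound R n n.-1 = 2 * Num.sqrt 2 * n%:R - gap_alpha R.
Proof.
case: n => [|[|[|n]]] // _; rewrite /SO_bound /=.
have -> : (n.+2 + 3 <= n.+3)%N = false by lia.
rewrite /gap_alpha; ring.
Qed.

(** With [SO_bound_lt] this shows that a single edge beyond n already exceeds every bound with k <=
    n - 3. *)
Lemma gap_alpha_gt (R : realType) : 4 * gap R 2 3 < gap_alpha R.
Proof.
have := gap23E R; rewrite /gap_alpha; have /andP[? ?] := sqrt2_bounds R.
have /andP[? ?] := sqrt5_bounds R; have /andP[? ?] := sqrt13_bounds R; lra.
Qed.

(** The total gap of P_n^k is 0 or 3 [gap R 2 3], except for k = 1, where the claim amounts to gap 1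
    3 < 2 gap 2 3. *)
Lemma SO_bound_lt (R : realType) n k : (k + 3 <= n)%N ->
  SO_bound R n k < 2 * Num.sqrt 2 * n%:R + 4 * gap R 2 3.
Proof.
case: k => [|[|k]] kn; first by rewrite SO_bound0; have := gap23_gt0 R; lra.
  rewrite SO_bound1 gap13E; have := gap23E R; have /andP[? ?] := sqrt2_bounds R.
  have /andP[? ?] := sqrt5_bounds R; have /andP[? ?] := sqrt13_bounds R.
  have /andP[? ?] := sqrt10_bounds R; lra.
by rewrite SO_bound_mid //; have := gap23_gt0 R; lra.
Qed.

(** Only edges at u_1 can have a nonzero gap. There are none in a path or a cycle; otherwise u_1 has
    degree 3, and one of its neighbours is the leaf exactly when k = 1. *)
Lemma Sombor_pnk (R : realType) n k : (2 < n)%N ->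
  (k + 3 <= n)%N \/ k = (n - 1)%N -> Sombor R (pnk n k) = SO_bound R n k.
Proof.
move=> n2; have oT : (2 < #|'I_n|)%N by rewrite card_ord.
case=> [kn|->]; last first.
  rewrite subn1 Sombor_gap => [|x]; last by apply: deg_gt0 (gconnected_pnk _ _) (ltnW oT).
  rewrite big1 => [|A AE]; last first.
    apply: edge_gap_eq0 => // [|x _]; first exact: gconnected_pnk.
    by have := deg_pnk_path x (ltnW n2); lia.
  rewrite SO_bound_path // card_ord.
  have := congr1 (fun m => m%:R : R) (card_edges_pnk_path (ltnW n2)); rewrite -natr1 /=.
  by move=> /(canRL (addrK 1)) ->; ring.
have cG := gconnected_pnk n k.
rewrite Sombor_gap => [|x]; last exact: deg_gt0 cG (ltnW oT).
rewrite card_ord card_edges_pnk // subrr mulr0 addr0.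
have cn : ((n - k).-1 < n)%N by lia.
pose u := Ordinal cn.
have le2 x : x != u -> (deg (pnk n k) x <= 2)%N.
  by rewrite -val_eqE /=; have := deg_pnk x kn; lia.
rewrite (sum_edge_gap_star R (u := u)) //.
have du := deg_pnk u kn; rewrite /= eqxx in du.
have dy y : pnk n k u y -> y != n.-1 :> nat -> deg (pnk n k) y = 2%N.
  by move=> /adj_neq; rewrite -val_eqE /=; have := deg_pnk y kn; lia.
case: k => [|[|k]] in kn cG cn u le2 du dy *.
- have du2 : deg (pnk n 0) u = 2%N by lia.
  rewrite SO_bound0 big1 ?addr0 // => y _; rewrite du2.
  have -> : deg (pnk n 0) y = 2%N by have := deg_pnk y kn; lia.
  exact: gap22.
- have du3 : deg (pnk n 1) u = 3%N by lia.
  have ln : (n.-1 < n)%N by lia.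
  pose l := Ordinal ln.
  have dl : deg (pnk n 1) l = 1%N by have := deg_pnk l kn; rewrite /= eqxx; lia.
  have ul : l \in [set y | pnk n 1 u y] by rewrite inE pnkE /pnk_arc /=; lia.
  rewrite (big_setD1 l) //= du3 dl SO_bound1 gapC; congr (_ + (_ + _)).
  rewrite (eq_bigr (fun=> gap R 2 3)) => [|y].
    rewrite sumr_const -[LHS]mulr_natl; congr (_%:R * _).
    by move: (etrans (esym du3) (cardsD1 l _)); rewrite ul add1n => -[].
  rewrite !inE -val_eqE /= => /andP[yl uy]; rewrite gapC dy //.
- have du3 : deg (pnk n k.+2) u = 3%N by lia.
  rewrite SO_bound_mid // (eq_bigr (fun=> gap R 2 3)) => [|y].
    by rewrite sumr_const -/(deg _ _) du3 -[X in _ + X]mulr_natl.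
  rewrite inE => uy; rewrite du3 gapC dy //.
  by move: uy; rewrite pnkE /pnk_arc /=; lia.
Qed.

(** * Comparison of an arbitrary graph with P_n^k *)

(** The average degree is 2, so a degree above 2 forces one below. *)
Lemma leaf_of_sum_deg (T : finType) (G : sgraph T) (u : T) :
  (forall x, 0 < deg G x)%N -> #|edges G| = #|T| -> (2 < deg G u)%N ->
  exists a, deg G a = 1%N.
Proof.
move=> dpos mn du; case: (boolP [exists a, deg G a == 1%N]).
  by case/existsP => a /eqP; exists a.
rewrite negb_exists => /forallP H.
have : (\sum_x (2 + (x == u)) <= \sum_x deg G x)%N.
  apply: leq_sum => x _; have := H x; have := dpos x.
  by case: (eqVneq x u) => [->|_]; rewrite ?addn0; lia.
rewrite sum_deg big_split /= sum_nat_const (bigD1 u) //= eqxx mn.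
by rewrite -[#|predT|]/#|T|; lia.
Qed.

(** The degrees average 2 and exceed 2 by at most 1 in total, so they cannot fall short of 2 at two
    vertices. *)
Lemma unique_leaf (T : finType) (G : sgraph T) (u a b : T) :
  #|edges G| = #|T| -> (forall x, deg G x <= 2 + (x == u))%N ->
  deg G a = 1%N -> (deg G b <= 1)%N -> b = a.
Proof.
move=> mn dle da db; apply/eqP; apply: contraT => ba.
have sum1 z : (\sum_(x : T) (x == z) = 1)%N.
  by rewrite (bigD1 z) //= eqxx big1 // => x /negbTE->.
have : (\sum_x (deg G x + ((x == a) + (x == b))) <= \sum_x (2 + (x == u)))%N.
  apply: leq_sum => x _; have := dle x; case: (eqVneq x a) => [->|_].
    by rewrite [a == b]eq_sym (negbTE ba) da; lia.
  by case: (eqVneq x b) => [->|_]; lia.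
by rewrite !big_split /= sum_deg !sum1 sum_nat_const mn -[#|predT|]/#|T|; lia.
Qed.

(** This dichotomy yields the bound and the equality case together. *)
Lemma giso_or_SO_bound_lt (R : realType) n k (T : finType) (G : sgraph T) :
  (2 < n)%N -> (k + 3 <= n)%N \/ k = (n - 1)%N -> gconnected G ->
  #|T| = n -> #|bridges G| = k ->
  giso G (pnk n k) \/ SO_bound R n k < Sombor R G.
Proof.
move=> n2 hk cG Tn Bk; have T2 : (2 < #|T|)%N by rewrite Tn.
have dpos x : (0 < deg G x)%N by apply: deg_gt0 (ltnW T2).
have mge := gconnected_card_edges cG; rewrite Tn in mge.
have H0 := sum_edge_gap_ge0 R cG T2.
have g0 := gap23_gt0 R; have ag := gap_alpha_gt R.
rewrite (Sombor_gap R dpos) Tn.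
have [mn|mn] := leqP n #|edges G|; last first.
  have mE : #|edges G|.+1 = n by lia.
  have kE : k = n.-1 by rewrite -Bk tree_bridges ?Tn //; lia.
  have mR : #|edges G|%:R - n%:R = -1 :> R by rewrite -mE -natr1; ring.
  rewrite kE SO_bound_path // mR.
  have [le2|[u [_ _ ?]]|?] := deg_gap_cases R cG T2; [left|right; lra|right; lra].
  have [a da] : exists a, deg G a = 1%N.
    case: (boolP [exists a, deg G a == 1%N]) => [/existsP[a /eqP]|]; first by exists a.
    rewrite negb_exists => /forallP H.
    have : (\sum_(x : T) 2 <= \sum_x deg G x)%N.
      by apply: leq_sum => x _; have := H x; have := dpos x; lia.
    by rewrite sum_deg sum_nat_const -[#|predT|]/#|T| Tn; lia.
  apply: (giso_path (a := a)) => // x; case: eqP => [->|_]; first by rewrite da.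
  by rewrite addn0.
have mR : 0 <= #|edges G|%:R - n%:R :> R by rewrite subr_ge0 ler_nat.
have amR : 0 <= gap_alpha R * (#|edges G|%:R - n%:R) by apply: mulr_ge0 => //; lra.
(* With at least n edges the index is at least sqrt 8 n, while the bound for k = n - 1 is smaller
   than that by [gap_alpha R]. *)
case: hk => [kn|kE]; last first.
  by right; rewrite kE subn1 SO_bound_path //; lra.
have bl := SO_bound_lt R kn.
move: mn; rewrite leq_eqVlt => /orP[/eqP mn|mn]; last first.
  right; have : 1 <= #|edges G|%:R - n%:R :> R by rewrite lerBrDr nat1r ler_nat.
  nra.
(* An isomorphism with any P_n^k' suffices: counting bridges gives k' = k. *)
have same k' : (k' + 3 <= n)%N -> giso G (pnk n k') -> giso G (pnk n k).
  by move=> kn' gi; rewrite -Bk (giso_bridges gi) card_bridges_pnk.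
have [le2|[u [du le2 _]]|?] := deg_gap_cases R cG T2; last by right; lra.
  (* The degrees are at most 2 and add up to 2n. *)
  have d2 x : deg G x = 2%N.
    have : (\sum_x (2 - deg G x) = 0)%N.
      rewrite sumnB // sum_deg sum_nat_const -[#|predT|]/#|T| -mn Tn; lia.
    by move=> /eqP; rewrite sum_nat_eq0 => /forallP/(_ x)/=; have := le2 x; lia.
  have [a _] : exists a : T, a \in T by apply/card_gt0P; rewrite Tn; lia.
  (* In a cycle any vertex serves both as the start of the path and as the branching vertex. *)
  have [|||k' kn' gi] := @giso_unicyclic _ G n a a cG Tn; last by left; apply: same gi.
  - by lia.
  - by move=> x; rewrite d2.
  - by move=> x _; rewrite d2.
have mT : #|edges G| = #|T| by rewrite Tn.
have dle x : (deg G x <= 2 + (x == u))%N.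
  by case: eqVneq => [->|/le2]; rewrite ?du ?addn0.
have [a da] : exists a, deg G a = 1%N by apply: (leaf_of_sum_deg (u := u)); rewrite ?du.
have [|||k' kn' gi] := @giso_unicyclic _ G n a u cG Tn; last by left; apply: same gi.
- by lia.
- move=> x; case: (eqVneq x a) => [->|_]; last by rewrite addn0.
  by rewrite da.
- move=> x; apply: contraNT; rewrite -leqNgt => dx.
  by apply/eqP; apply: (unique_leaf mT dle da).
Qed.

Theorem theorem4p5 (R : realType) (n k : nat) (T : finType) (G : sgraph T)
    (hn : (3 <= n)%N)
    (hk : (k + 3 <= n)%N \/ k = (n - 1)%N)
    (hG : gconnected G)
    (hT : #|T| = n)
    (hB : #|bridges G| = k) :
  SO_bound R n k <= Sombor R G /\
  (Sombor R G = SO_bound R n k <-> giso G (pnk n k)).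
Proof.
have isoE : giso G (pnk n k) -> Sombor R G = SO_bound R n k.
  by move=> /(giso_Sombor R)->; apply: Sombor_pnk.
have [gi|lt] := giso_or_SO_bound_lt R hn hk hG hT hB.
  by split; [rewrite isoE | split=> // _].
split; first exact: ltW.
by split=> // E; rewrite E ltxx in lt.
Qed.
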